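(* Let $\mu(v_1\otimes v_2)=v_1\cup v_2$ be the cup product of Vassiliev invariants of knots in $\mathbf R^3$, viewed as cochains on ordered singular knots. Then $$W_{p+q}\circ\mu=(\Delta^0)^*\circ(W_p\otimes W_q),$$ i.e., if $v_1\in\mathbb V_p$ and $v_2\in\mathbb V_q$, then $$W_{p+q}(v_1\cup v_2)=(-1)^{pq}\,(W_p(v_1)\otimes W_q(v_2))\circ\Delta^0 .$$
   Context: Singular knots and cup product. $X_n^0$ is the set of $n$-singular knots $K_{1\ldots n}$ in $\mathbf R^3$ (immersed directed circles, embedded except for $n$ transverse double points) with double points ordered $1,\dots,n$, up to direction- and label-preserving rigid-vertex isotopy. A knot invariant with values in $\mathbf Q$ is extended to singular knots by $v(K_\times)=v(K_+)-v(K_-)$; $\mathbb V_n$ is the space of invariants vanishing on all $(n+1)$-singular knots. For $v_1\in\mathbb V_p$, $v_2\in\mathbb V_q$, regarded as a $p$-cochain and a $q$-cochain, and $n=p+q$, $$v_1\cup v_2(K_{1\ldots n})=\sum_{H\subset\{1\ldots n\},\,|H|=p}\rho_{(HK)}\,v_1(\mathrm d_K^-K_{1\ldots n})\,v_2(\mathrm d_H^+K_{1\ldots n}),$$ where $K$ is the complement of $H$, both in natural order, $\rho_{(HK)}$ is the sign of the permutation taking the concatenated sequence $(HK)$ to $(1\ldots n)$, $\mathrm d_K^-$ takes negative resolutions at all double points with labels in $K$ and $\mathrm d_H^+$ positive resolutions at all double points with labels in $H$. Ordered chord diagrams. $\mathfrak D^0_n$ is the $\mathbf Q$-vector space with basis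 the chord diagrams with $n$ chords on a counterclockwise directed circle, chords labelled $1,\dots,n$, up to rotation. The ordered 4T relations are: take a labelled chord diagram with a chord $i$ (fixed) with endpoints $p,q$, and a chord $j\ne i$ (moving) with one endpoint held fixed and the other placed, along the direction of the circle, immediately before or immediately after $p$ or $q$, everything else and all labels the same; then (before $p$) $-$ (after $p$) $+$ (before $q$) $-$ (after $q$) $=0$. $\mathcal A^0=\bigoplus\mathcal A_n^0$ is the quotient of $\mathfrak D^0=\bigoplus\mathfrak D_n^0$ by all ordered 4T relations. The coproduct is $\Delta^0(D)=\sum_{H\subset\{1\ldots n\}}\rho_{(HK)}D_K\otimes D_H$ for $D\in\mathfrak D_n^0$, where $D_H$ is $D$ with the chords with labels in $H$ removed, with induced ordering; it descends to $\mathcal A^0$. Weight systems. For an $n$-cochain $u$ (such as $v\in\mathbb V_n$ or $v_1\cup v_2$ with $n=p+q$), $W_n(u)(D_{1\ldots n})=u(K_{1\ldots n})$, where $K_{1\ldots n}$ is any ordered $n$-singular knot whose chord diagram is $D_{1\ldots n}$; for $v\in\mathbb V_n$ this lies in $(\mathcal A_n^0)^*$. Graded sign conventions: $W_n$ is a graded map, $(W_p\otimes W_q)(v_1\otimes v_2)=(-1)^{pq}W_p(v_1)\otimes W_q(v_2)$, and for functionals $f,g$ of degrees $p,q$ one has $(f\otimes g)(a\otimes b)=(-1)^{|g||a|}f(a)g(b)$ for homogeneous $a,b$ (functionals being zero off their own degree). *)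

(* Defs.v *)
From HB Require Import structures.
From mathcomp Require Import freeg.
From mathcomp Require Import all_boot all_order all_fingroup all_algebra.
From mathcomp Require Import generic_quotient.
From mathcomp Require Import all_classical all_reals all_analysis.

Set Implicit Arguments.
Unset Strict Implicit.
Unset Printing Implicit Defensive.

Import Order.TTheory GRing.Theory Num.Theory.
Import numFieldNormedType.Exports.

Local Open Scope quotient_scope.
Local Open Scope classical_set_scope.
Local Open Scope ring_scope.

(** The circle is R/Z, and curves are 1-periodic functions on R.  Double points
    are labelled by ['I_n], i.e. 0, ..., n-1 instead of 1, ..., n. *)

Definition smooth (R : realType) (V : normedModType R) (f : R -> V) : Prop :=
  forall k x, derivable (derive1n k f) x 1.

Definition periodic1 (R : realType) (V : Type) (f : R -> V) : Prop :=
  forall x, f (x + 1) = f x.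

(** The parameters [lo i < hi i] in [0, 1[ of the two preimages of the double
    point number [i] are determined by the curve and the labelling.  As all the
    parameters are distinct, [knot_double] excludes triple points. *)
Record sknot (R : realType) (n : nat) := SKnot {
  curve : R -> 'rV[R]_3;
  lo : 'I_n -> R;
  hi : 'I_n -> R;
  knot_smooth : smooth curve;
  knot_periodic : periodic1 curve;
  knot_immersed : forall x, derive1 curve x != 0;
  knot_range : forall i, [/\ 0 <= lo i, lo i < hi i & hi i < 1];
  knot_lo_inj : injective lo;
  knot_hi_inj : injective hi;
  knot_lo_hi : forall i j, lo i != hi j;
  knot_double : forall x y, 0 <= x -> x < y -> y < 1 ->
    curve x = curve y <-> exists i, x = lo i /\ y = hi i;
  knot_transverse : forall i,
    row_free (col_mx (derive1 curve (lo i)) (derive1 curve (hi i)))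
}.

(** Directed, labelled rigid-vertex isotopy: a path in the space of ordered
    n-singular knots, for the smooth topology on curves.  The rigidity of the
    vertices is the transversality of the double points throughout.  The labels
    are followed through the points of space, since a parameter may jump when
    the double point crosses the base point of R/Z. *)
Definition isotopic (R : realType) (n : nat) (K K' : sknot R n) : Prop :=
  exists F : R -> sknot R n,
    [/\ F 0 = K, F 1 = K',
        forall k : nat,
          {within [set z : R * R | 0 <= z.1 <= 1],
            continuous (fun z : R * R => derive1n k (curve (F z.1)) z.2)}
      & forall i : 'I_n,
          {within [set tau : R | 0 <= tau <= 1],
            continuous (fun tau : R => curve (F tau) (lo (F tau) i))}].

Definition double_param (R : realType) (n : nat) (K : sknot R n) : set R :=
  [set x | exists i, x = lo K i \/ x = hi K i].

Definition det3 (R : realType) (a b c : 'rV[R]_3) : R :=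
  \det (col_mx a (col_mx b c) : 'M[R]_3).

(** [resolves K i pos K']: [K'] is a positive (if [pos]) or negative resolution
    of [K] at the double point [i], the other double points keeping their order.
    The branch of [K] through [lo K i] is pushed off the other one, by [phi]
    times the vector [nu], inside an arc ]a, b[ that meets no other preimage of
    a double point.  All the intermediate stages are singular knots, so that no
    other crossing is changed.  A crossing of branches x, y of a curve g is
    positive when det (g'(x), g'(y), g(x) - g(y)) > 0; after the push this has
    the sign of det (g'(lo i), g'(hi i), nu). *)
Definition resolves (R : realType) (n : nat) (K : sknot R n.+1) (i : 'I_n.+1)
    (pos : bool) (K' : sknot R n) : Prop :=
  exists (phi : R -> R) (nu : 'rV[R]_3) (a b : R) (F : R -> sknot R n),
    [/\ [/\ smooth phi, periodic1 phi, forall x, 0 <= phi x & 0 < phi (lo K i)],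
        [/\ a < lo K i < b,
            forall x, phi x != 0 -> exists m : int, a < x + m%:~R < b
          & forall y (m : int), double_param K y -> a < y + m%:~R < b ->
              y = lo K i],
        0 < (-1) ^+ (~~ pos) *
            det3 (derive1 (curve K) (lo K i)) (derive1 (curve K) (hi K i)) nu,
        forall lam, 0 < lam <= 1 ->
          [/\ curve (F lam) = (fun x => curve K x + (lam * phi x) *: nu),
              forall j, lo (F lam) j = lo K (lift i j)
            & forall j, hi (F lam) j = hi K (lift i j)]
      & F 1 = K'].

(** [resolves_set pos K S K']: [K'] is obtained from [K] by resolutions, all of
    sign [pos], at all the double points with labels in [S]. *)
Inductive resolves_set (R : realType) (pos : bool) :
    forall n m : nat, sknot R n -> {set 'I_n} -> sknot R m -> Prop :=
| resolves_none n (K : sknot R n) : resolves_set pos K (finset.set0) K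
| resolves_more n m (K : sknot R n.+1) (i : 'I_n.+1) (K' : sknot R n)
    (S : {set 'I_n}) (K'' : sknot R m) :
    resolves K i pos K' -> resolves_set pos K' S K'' ->
    resolves_set pos K (i |: [set lift i j | j in S])%SET K''.

(** The resolution of [K] at [S] is unique up to isotopy, so for an invariant [u]
    the set below has one element: the value of [u] on that resolution. *)
Definition at_resolution (R : realType) (n m : nat) (u : sknot R m -> rat)
    (K : sknot R n) (S : {set 'I_n}) (pos : bool) : rat :=
  xget 0 [set r | exists2 K', resolves_set pos K S K' & u K' = r].

(** A knot invariant together with its extension to singular knots, which
    [ival_skein] determines. *)
Record knot_invariant (R : realType) := Invariant {
  ival :> forall n : nat, sknot R n -> rat;
  ival_isotopic : forall n (K K' : sknot R n),
    isotopic K K' -> ival K = ival K';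
  ival_skein : forall n (K : sknot R n.+1) (i : 'I_n.+1) (Kp Km : sknot R n),
    resolves K i true Kp -> resolves K i false Km ->
    ival K = ival Kp - ival Km
}.

Definition vassiliev (R : realType) (n : nat) (v : knot_invariant R) : Prop :=
  forall K : sknot R n.+1, v n.+1 K = 0.

Lemma shuffle_inj (n : nat) (H : {set 'I_n}) :
  injective (fun k : 'I_n => nth k (enum H ++ enum (~: H)%SET) k).
Proof.
have sz : size (enum H ++ enum (~: H)%SET) = n.
  by rewrite size_cat -!cardE cardsC card_ord.
have un : uniq (enum H ++ enum (~: H)%SET).
  rewrite cat_uniq !enum_uniq andbT /=; apply/hasPn => x.
  by rewrite !mem_enum inE.
move=> k l; rewrite (set_nth_default l) ?sz // => /eqP.
by rewrite nth_uniq ?sz // => /eqP/val_inj.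
Qed.

Definition rho (n : nat) (H : {set 'I_n}) : rat :=
  (-1) ^+ odd_perm (perm (@shuffle_inj n H)).

Definition cup (R : realType) (p q : nat) (u1 : sknot R p -> rat)
    (u2 : sknot R q -> rat) (K : sknot R (p + q)) : rat :=
  \sum_(H : {set 'I_(p + q)} | #|H| == p)
    rho H * at_resolution u1 K (~: H)%SET false * at_resolution u2 K H true.

(** A chord diagram with n labelled chords, read counterclockwise from a base
    point, is a word of length 2n in which each label 0, ..., n-1 occurs twice. *)
Definition is_cword (w : seq nat) : bool :=
  let n := (size w)./2 in perm_eq w (iota 0 n ++ iota 0 n).

Record cword := CWord { cword_seq :> seq nat; _ : is_cword cword_seq }.

HB.instance Definition _ := [isSub for cword_seq].
HB.instance Definition _ := [Choice of cword by <:].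

Definition rot_rel (w1 w2 : cword) : bool :=
  [exists k : 'I_(size w1).+1, rot k w1 == w2 :> seq nat].

Lemma rot_rel_refl : reflexive rot_rel.
Proof. by move=> w; apply/existsP; exists ord0; rewrite rot0. Qed.

Lemma rot_rel_sym : symmetric rot_rel.
Proof.
suff imp w1 w2 : rot_rel w1 w2 -> rot_rel w2 w1.
  by move=> w1 w2; apply/idP/idP; apply: imp.
case/existsP => k /eqP e.
have lt : (size w1 - k < (size w2).+1)%N by rewrite -e size_rot ltnS leq_subr.
apply/existsP; exists (Ordinal lt).
by rewrite /= -e -[X in (X - _)%N](size_rot k) -/(rotr k _) rotK.
Qed.

Lemma rot_rel_trans : transitive rot_rel.
Proof.
move=> w2 w1 w3 /existsP[[k /= lk] /eqP e] /existsP[[l /= ll] /eqP e'].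
move: ll e'; rewrite -!e size_rot ltnS => ll.
rewrite (rot_add_mod (lk : k <= size w1)%N ll) => e'; apply/existsP.
case: leqP e' => h /eqP e'; first by exists (Ordinal (h : (l + k < (size w1).+1)%N)).
have lt : (l + k - size w1 < (size w1).+1)%N.
  by rewrite ltnS leq_subLR leq_add.
by exists (Ordinal lt).
Qed.

Canonical rot_equiv :=
  EquivRel rot_rel rot_rel_refl rot_rel_sym rot_rel_trans.

Definition cdiag := {eq_quot rot_equiv}.
HB.instance Definition _ := Choice.on cdiag.
HB.instance Definition _ := Quotient.on cdiag.

Definition cdiag_of (w : cword) : cdiag := \pi_cdiag w.

Definition nchords (D : cdiag) : nat := (size (repr D : cword))./2.

(** Removal of the chords with labels in [X]; a remaining label [x] becomes the
    number of remaining labels smaller than [x]. *)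
Definition relabel (X : pred nat) (x : nat) : nat := count (predC X) (iota 0 x).

Definition erase (X : pred nat) (w : seq nat) : seq nat :=
  [seq relabel X x | x <- w & ~~ X x].

Lemma erase_iota (X : pred nat) (n : nat) :
  erase X (iota 0 n) = iota 0 (relabel X n).
Proof.
rewrite /erase /relabel; elim: n => // n IH.
rewrite -addn1 iotaD filter_cat map_cat IH count_cat /= add0n addn0 iotaD.
by case: (X n) => //=; rewrite add0n.
Qed.

Lemma erase_cword (X : pred nat) (w : cword) : is_cword (erase X w).
Proof.
case: w => w /= cw; set n := (size w)./2 in cw.
have pe : perm_eq (erase X w) (erase X (iota 0 n) ++ erase X (iota 0 n)).
  by rewrite -map_cat -filter_cat; apply/perm_map/perm_filter.
rewrite /is_cword (perm_size pe) size_cat addnn doubleK (perm_trans pe) //.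
by rewrite !erase_iota size_iota.
Qed.

Definition remove (X : pred nat) (D : cdiag) : cdiag :=
  cdiag_of (CWord (erase_cword X (repr D))).

Definition labels (n : nat) (H : {set 'I_n}) : pred nat :=
  fun x => [exists i in H, val i == x].

(** The chord diagram of a singular knot lists the labels of the double points
    in the order in which the curve runs through them. *)
Definition knot_word (R : realType) (n : nat) (K : sknot R n) : seq nat :=
  [seq x.2 | x <- sort (fun x y : R * nat => x.1 <= y.1)
                       ([seq (lo K i, val i) | i <- enum 'I_n] ++
                        [seq (hi K i, val i) | i <- enum 'I_n])].

Lemma knot_cword (R : realType) (n : nat) (K : sknot R n) :
  is_cword (knot_word K).
Proof.
have snds (f : 'I_n -> R) :
    [seq x.2 | x <- [seq (f i, val i) | i <- enum 'I_n]] = iota 0 n.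
  by rewrite -map_comp -[RHS]val_enum_ord; apply: eq_map.
have pe : perm_eq (knot_word K) (iota 0 n ++ iota 0 n).
  rewrite /knot_word; apply: (perm_trans (perm_map _ (permEl (perm_sort _ _)))).
  by rewrite map_cat !snds.
by rewrite /is_cword (perm_size pe) size_cat size_iota addnn doubleK.
Qed.

Definition knot_diag (R : realType) (n : nat) (K : sknot R n) : cdiag :=
  cdiag_of (CWord (knot_cword K)).

(** The direct sum over n of the spaces of diagrams with n chords, and its
    tensor square. *)
Definition D0 := {freeg cdiag / rat}.
Definition D0D0 := {freeg (cdiag * cdiag) / rat}.
HB.instance Definition _ := GRing.Lmodule.on D0.
HB.instance Definition _ := GRing.Lmodule.on D0D0.

Definition lin_ext (T : choiceType) (M : lmodType rat) (f : T -> M)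
    (x : {freeg T / rat}) : M := fglift f x.

Lemma lin_ext_linear (T : choiceType) (M : lmodType rat) (f : T -> M) :
  linear (lin_ext f).
Proof.
have add x y : lin_ext f (x + y) = lin_ext f x + lin_ext f y.
  have sub := @lift_is_additive rat T M f.
  have l0 : lin_ext f 0 = 0 by rewrite /lin_ext -(subrr 0) sub subrr.
  rewrite /lin_ext -[y in LHS]opprK sub -[- y]sub0r sub.
  by rewrite [fglift f 0]l0 sub0r opprK.
have scale a x : lin_ext f (a *: x) = a *: lin_ext f x.
  elim/freeg_ind_dom0: x => [|k z x _ _ IH].
    by rewrite scaler0 -(subrr 0) /lin_ext lift_is_additive subrr scaler0.
  rewrite scalerDr !add IH scalerDr; congr (_ + _).
  have -> : a *: << k *g z >> = << a * k *g z >> :> {freeg T / rat}.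
    by apply/eqP/freeg_eqP => t; rewrite coeffZ !coeffU mulrA.
  by rewrite /lin_ext !liftU scalerA.
by move=> a x y; rewrite add scale.
Qed.

HB.instance Definition _ (T : choiceType) (M : lmodType rat) (f : T -> M) :=
  GRing.isLinear.Build rat {freeg T / rat} M *:%R (lin_ext f) (lin_ext_linear f).

Definition Delta0 : {linear D0 -> D0D0} :=
  lin_ext (fun D : cdiag =>
    \sum_(H : {set 'I_(nchords D)})
      rho H *: << (remove (labels (~: H)%SET) D, remove (labels H) D) >> : D0D0).

(** [tensor q f g] is the functional f (x) g, where g has degree q. *)
Definition tensor (q : nat) (f g : {linear D0 -> rat^o}) : {linear D0D0 -> rat^o} :=
  lin_ext (fun D : cdiag * cdiag =>
    (-1) ^+ (q * nchords D.1) * f << D.1 >> * g << D.2 >> : rat^o).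

(** Ordered 4T relations.  In a word a ++ i :: b ++ i :: c one end of the chord
    j is placed before or after each of the two ends of i; the other end of j
    is in a, b or c. *)
Definition wdiag (w : seq nat) (cw : is_cword w) : D0 := << cdiag_of (CWord cw) >>.

Definition fourT (r : D0) : Prop :=
  exists (i j : nat) (a b c : seq nat)
    (c1 : is_cword (a ++ [:: j; i] ++ b ++ [:: i] ++ c))
    (c2 : is_cword (a ++ [:: i; j] ++ b ++ [:: i] ++ c))
    (c3 : is_cword (a ++ [:: i] ++ b ++ [:: j; i] ++ c))
    (c4 : is_cword (a ++ [:: i] ++ b ++ [:: i; j] ++ c)),
    r = wdiag c1 - wdiag c2 + wdiag c3 - wdiag c4.

(** The functionals on D0 that descend to the quotient A0 of D0 by all ordered
    4T relations, i.e. the dual of A0. *)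
Definition A0_dual (f : D0 -> rat) : Prop := forall r, fourT r -> f r = 0.

Definition homogeneous (n : nat) (f : D0 -> rat) : Prop :=
  forall D : cdiag, nchords D != n -> f << D >> = 0.

(** [weight_system u w] means w = W_n(u): the functional [w] of degree n takes
    on each ordered chord diagram the value of [u] on any ordered n-singular
    knot with that diagram. *)
Definition weight_system (R : realType) (n : nat) (u : sknot R n -> rat)
    (w : {linear D0 -> rat^o}) : Prop :=
  homogeneous n w /\ forall K : sknot R n, w << knot_diag K >> = u K.

(* Main.v *)
(** The chord diagram of any resolution of K at a set S of double points is the
    diagram of K with the chords in S removed.  Hence each value
    v_1(d_K^- K_{1..n}) v_2(d_H^+ K_{1..n}) in the cup product depends only on
    the diagram and is the term of index H in the coproduct, up to the sign
    (-1)^{pq} of the tensor product of functionals, which the sign (-1)^{pq} of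
    the statement cancels.

    As [at_resolution] has the junk value 0 where no resolution exists, the
    existence of resolutions is needed.  Near the double point, one branch is
    pushed by a small bump times a vector nu independent of the two tangents.
    The two coordinates dual to the tangents are unchanged by the push.  They
    separate the points near the double point, except the two preimages of the
    double point itself, and those are separated by nu.  A compactness argument
    keeps the push away from the rest of the curve.

    That the functional descends to A^0 is seen term by term in the coproduct:
    if the fixed and the moving chord of a 4T relation stay in the same factor,
    this factor is a 4T relation, and otherwise the four terms cancel in pairs. *)

Require Import Defs.
From mathcomp Require Import freeg.
From mathcomp Require Import all_boot all_order all_fingroup all_algebra.
From mathcomp Require Import all_classical all_reals all_analysis.
From mathcomp Require Import generic_quotient zify ring lra.

Import Order.TTheory GRing.Theory Num.Theory.
Import numFieldNormedType.Exports.

Set Implicit Arguments.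
Unset Strict Implicit.
Unset Printing Implicit Defensive.

Local Open Scope ring_scope.

(** * Coproduct and 4T relations on words *)

Lemma count_mem_cword (w : seq nat) (x : nat) :
  is_cword w -> count_mem x w = (if (x < (size w)./2)%N then 2 else 0)%N.
Proof.
move=> /seq.permP/(_ (pred1 x)) ->.
by rewrite count_cat !count_uniq_mem ?iota_uniq // mem_iota add0n; case: ifP.
Qed.

Lemma erase_cat (X : pred nat) (s t : seq nat) :
  erase X (s ++ t) = erase X s ++ erase X t.
Proof. by rewrite /erase filter_cat map_cat. Qed.

Lemma eq_erase (X Y : pred nat) (s : seq nat) :
  X =1 Y -> erase X s = erase Y s.
Proof.
move=> XY; rewrite /erase (@eq_filter _ _ (fun x => ~~ Y x)); last first.
  by move=> x; rewrite XY.
by apply: eq_map => x; apply: eq_count => y /=; rewrite XY.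
Qed.

Lemma size_erase_cword (X : pred nat) (w : seq nat) :
  is_cword w -> (size (erase X w))./2 = relabel X (size w)./2.
Proof.
move=> cw; set n := (size w)./2 in cw *.
have pe : perm_eq (erase X w) (erase X (iota 0 n) ++ erase X (iota 0 n)).
  by rewrite -erase_cat; apply/perm_map/perm_filter.
by rewrite (perm_size pe) erase_iota size_cat size_iota addnn doubleK.
Qed.

Lemma labelsE (n : nat) (H : {set 'I_n}) (x : 'I_n) : labels H x = (x \in H).
Proof.
apply/existsP/idP => [[y /andP[Hy /eqP/val_inj <-]]//|Hx].
by exists x; rewrite Hx eqxx.
Qed.

Lemma labels_ge (n : nat) (H : {set 'I_n}) (x : nat) :
  (n <= x)%N -> labels H x = false.
Proof.
move=> nx; apply/negbTE/negP => /existsP[y /andP[_ /eqP yx]].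
by have := ltn_ord y; rewrite yx ltnNge nx.
Qed.

Lemma relabel_labels (n : nat) (H : {set 'I_n}) :
  relabel (labels H) n = #|~: H|%SET.
Proof.
rewrite /relabel -val_enum_ord count_map cardE size_filter.
rewrite -enumT; apply: eq_count => x /=.
by rewrite labelsE inE.
Qed.

Lemma rotationP (w1 w2 : cword) :
  reflect (exists s t, w1 = s ++ t :> seq nat /\ w2 = t ++ s :> seq nat)
          (rot_rel w1 w2).
Proof.
apply: (iffP existsP) => [[k /eqP e]|[s [t [e1 e2]]]].
  by exists (take k w1), (drop k w1); rewrite cat_take_drop -e.
have lt : (size s < (size w1).+1)%N by rewrite e1 size_cat ltnS leq_addr.
by exists (Ordinal lt); rewrite /= e1 e2 rot_size_cat.
Qed.

Lemma cdiag_ofP (w1 w2 : cword) : reflect (cdiag_of w1 = cdiag_of w2) (rot_rel w1 w2).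
Proof. exact: (iffP (eqmodP _ _ _)). Qed.

Lemma cdiag_of_eq (w1 w2 : cword) :
  w1 = w2 :> seq nat -> cdiag_of w1 = cdiag_of w2.
Proof. by move=> e; congr cdiag_of; apply: val_inj. Qed.

Lemma nchords_cdiag_of (w : cword) : nchords (cdiag_of w) = (size w)./2.
Proof.
rewrite /nchords; have /cdiag_ofP/rotationP[s [t [-> ->]]] :
  cdiag_of (repr (cdiag_of w)) = cdiag_of w by exact: reprK.
by rewrite !size_cat addnC.
Qed.

(** [remove] works on a chosen representative. Since [erase] commutes with concatenation, rotated
    words have rotated erasures and any representative will do. *)
Lemma remove_cdiag_of (X : pred nat) (w : cword) :
  remove X (cdiag_of w) = cdiag_of (CWord (erase_cword X w)).
Proof.
have /cdiag_ofP/rotationP[s [t [e1 e2]]] :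
  cdiag_of (repr (cdiag_of w)) = cdiag_of w by exact: reprK.
apply/cdiag_ofP/rotationP; exists (erase X s), (erase X t).
by rewrite /= e1 e2 !erase_cat.
Qed.

Lemma lin_ext_gen (T : choiceType) (M : lmodType rat) (f : T -> M) (x : T) :
  lin_ext f << x >> = f x.
Proof. by rewrite /lin_ext liftU scale1r. Qed.


(** The first factor keeps the chords of [H], whence the exponent [q * #|H|]. A separate [n] lets
    the four words of a 4T relation share one index type. *)
Lemma tensor_Delta0 (n q : nat) (f g : {linear D0 -> rat^o}) (w : cword) :
  (size w)./2 = n ->
  tensor q f g (Delta0 << cdiag_of w >>) =
  \sum_(H : {set 'I_n})
    rho H * ((-1) ^+ (q * #|H|) *
      f (wdiag (erase_cword (labels (~: H)%SET) w)) *
      g (wdiag (erase_cword (labels H) w))).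
Proof.
move=> sw; rewrite /Delta0 /tensor /= lin_ext_gen linear_sum /=.
have en : nchords (cdiag_of w) = n by rewrite nchords_cdiag_of.
case: n / en sw => sw; apply: eq_bigr => H _.
rewrite linearZ /=; congr (_ *: _); rewrite lin_ext_gen /= !remove_cdiag_of.
rewrite nchords_cdiag_of /= size_erase_cword; last by case: (w).
by rewrite sw relabel_labels finset.setCK.
Qed.

Lemma wdiag_eq (w w' : seq nat) (cw : is_cword w) (cw' : is_cword w') :
  w = w' -> wdiag cw = wdiag cw'.
Proof. by move=> e; rewrite /wdiag; congr << _ >>; apply: cdiag_of_eq. Qed.

Lemma homogeneous_wdiag (n : nat) (f : D0 -> rat) (w : seq nat)
    (cw : is_cword w) : homogeneous n f -> (size w)./2 != n -> f (wdiag cw) = 0.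
Proof. by move=> hf sw; apply: hf; rewrite nchords_cdiag_of. Qed.

(** The factors of a term have [#|H|] and [#|~: H|] chords, which add up to the number of chords of
    the diagram; unless this is [p + q], one factor has the wrong degree. *)
Lemma homogeneous_tensor_Delta0 (p q : nat) (f g : {linear D0 -> rat^o}) :
  homogeneous p f -> homogeneous q g ->
  homogeneous (p + q) (tensor q f g \o Delta0).
Proof.
move=> hf hg D; rewrite -[D]reprK -/(cdiag_of _).
case: (repr D) => w cw; rewrite nchords_cdiag_of /= => sw.
rewrite -[LHS]/(tensor q f g (Delta0 << cdiag_of (CWord cw) >>)).
rewrite (tensor_Delta0 q f g (erefl (size (CWord cw))./2)) big1 // => H _.
have szE (X : {set 'I_(size w)./2}) :
  (size (erase (labels X) w))./2 = #|~: X|%SET.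
  by rewrite size_erase_cword // relabel_labels.
have [eH|nH] := eqVneq #|H| p; last first.
  by rewrite (homogeneous_wdiag _ hf) ?szE ?finset.setCK // mulr0 mul0r mulr0.
rewrite (homogeneous_wdiag _ hg) ?szE ?mulr0 //.
by apply: contra sw => /eqP cH; rewrite -eH -cH cardsC card_ord.
Qed.

(** Once one of the two chords is gone, it no longer matters on which side of an end of [i] the end
    of [j] lay. *)
Lemma erase_swap (X : pred nat) (i j : nat) (s t : seq nat) :
  X i || X j -> erase X (s ++ [:: i; j] ++ t) = erase X (s ++ [:: j; i] ++ t).
Proof. by move=> XX; rewrite !erase_cat /erase /=; case: (X i) (X j) XX => [] []. Qed.

Lemma erase_move (X : pred nat) (i j : nat) (s t u : seq nat) :
  X j -> erase X (s ++ [:: j; i] ++ t ++ [:: i] ++ u) =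
         erase X (s ++ [:: i] ++ t ++ [:: j; i] ++ u).
Proof. by move=> Xj; rewrite !erase_cat /erase /= Xj. Qed.

(** Erasing commutes with concatenation and renumbers [i] and [j] alike in all four words, so the
    shape of the relation survives. *)
Lemma fourT_erase (X : pred nat) (i j : nat) (a b c : seq nat)
    (c1 : is_cword (a ++ [:: j; i] ++ b ++ [:: i] ++ c))
    (c2 : is_cword (a ++ [:: i; j] ++ b ++ [:: i] ++ c))
    (c3 : is_cword (a ++ [:: i] ++ b ++ [:: j; i] ++ c))
    (c4 : is_cword (a ++ [:: i] ++ b ++ [:: i; j] ++ c)) :
  ~~ X i -> ~~ X j ->
  fourT (wdiag (erase_cword X (CWord c1)) - wdiag (erase_cword X (CWord c2))
       + wdiag (erase_cword X (CWord c3)) - wdiag (erase_cword X (CWord c4))).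
Proof.
move=> Xi Xj; set r := relabel X.
have eE : (erase X [:: i] = [:: r i]) * (erase X [:: j; i] = [:: r j; r i]) *
          (erase X [:: i; j] = [:: r i; r j]).
  by rewrite /erase /= Xi Xj.
have E1 : erase X (a ++ [:: j; i] ++ b ++ [:: i] ++ c) =
    erase X a ++ [:: r j; r i] ++ erase X b ++ [:: r i] ++ erase X c.
  by rewrite !erase_cat !eE.
have := erase_cword X (CWord c1); rewrite [X in is_cword X]E1 => e1.
have E2 : erase X (a ++ [:: i; j] ++ b ++ [:: i] ++ c) =
    erase X a ++ [:: r i; r j] ++ erase X b ++ [:: r i] ++ erase X c.
  by rewrite !erase_cat !eE.
have := erase_cword X (CWord c2); rewrite [X in is_cword X]E2 => e2.
have E3 : erase X (a ++ [:: i] ++ b ++ [:: j; i] ++ c) =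
    erase X a ++ [:: r i] ++ erase X b ++ [:: r j; r i] ++ erase X c.
  by rewrite !erase_cat !eE.
have := erase_cword X (CWord c3); rewrite [X in is_cword X]E3 => e3.
have E4 : erase X (a ++ [:: i] ++ b ++ [:: i; j] ++ c) =
    erase X a ++ [:: r i] ++ erase X b ++ [:: r i; r j] ++ erase X c.
  by rewrite !erase_cat !eE.
have := erase_cword X (CWord c4); rewrite [X in is_cword X]E4 => e4.
exists (r i), (r j), (erase X a), (erase X b), (erase X c), e1, e2, e3, e4.
by congr (_ - _ + _ - _); apply: wdiag_eq.
Qed.

Lemma A0_dual_tensor_Delta0 (q : nat) (f g : {linear D0 -> rat^o}) :
  A0_dual f -> A0_dual g -> A0_dual (tensor q f g \o Delta0).
Proof.
move=> hf hg _ [i [j [a [b [c [c1 [c2 [c3 [c4 ->]]]]]]]]].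
pose T := tensor q f g \o Delta0; rewrite -/T.
have TB u v : T (u - v) = T u - T v by rewrite /T /= !linearB.
have TD u v : T (u + v) = T u + T v by rewrite /T /= !linearD.
rewrite TB TD TB.
set n := (size (a ++ [:: j; i] ++ b ++ [:: i] ++ c))./2.
clear TB TD; rewrite {}/T /= ![wdiag _]/wdiag.
rewrite (@tensor_Delta0 n _ _ _ (CWord c1)) // (@tensor_Delta0 n _ _ _ (CWord c2)); last first.
  by rewrite /n /= !size_cat /= !size_cat /= !addnS.
rewrite (@tensor_Delta0 n _ _ _ (CWord c3)); last first.
  by rewrite /n /= !size_cat /= !size_cat /= !addnS.
rewrite (@tensor_Delta0 n _ _ _ (CWord c4)); last first.
  by rewrite /n /= !size_cat /= !size_cat /= !addnS.
rewrite -sumrB -big_split -sumrB big1 //= => H _.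
rewrite -mulrBr -mulrDr -mulrBr -!mulrA -mulrBr -mulrDr -mulrBr.
(* Both labels occur in the word, and a chord word has only labels below [n]. So [i] and [j] become
   elements of ['I_n] and can be tested against [H]. *)
have lt x : x \in [:: i; j] -> (x < n)%N.
  move=> xij; have := count_mem_cword x c1; rewrite -/n; case: ifP => // _ /eqP.
  rewrite !count_cat /=; move: xij; rewrite !inE => /orP[]/eqP->; rewrite eqxx /=; lia.
pose i' : 'I_n := Ordinal (lt i (mem_head _ _)).
have lj : (j < n)%N by rewrite lt // !inE eqxx orbT.
pose j' : 'I_n := Ordinal lj.
have Li K : labels K i = (i' \in K) := labelsE K i'.
have Lj K : labels K j = (j' \in K) := labelsE K j'.
have same (X : pred nat) : X i || X j ->
    wdiag (erase_cword X (CWord c1)) = wdiag (erase_cword X (CWord c2)) /\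
    wdiag (erase_cword X (CWord c3)) = wdiag (erase_cword X (CWord c4)).
  move=> Xij; split; apply: wdiag_eq => /=; first exact/esym/erase_swap.
  by have := @erase_swap X j i (a ++ i :: b) c; rewrite -!catA /= orbC; apply.
have same2 (X : pred nat) : X j ->
    wdiag (erase_cword X (CWord c1)) = wdiag (erase_cword X (CWord c3)).
  by move=> Xj; apply: wdiag_eq; apply: erase_move.
(* A factor without the moving chord is the same in all four terms; the other factor, keeping both
   chords, runs through a 4T relation. *)
have both (X Y : pred nat) : X j -> ~~ Y i -> ~~ Y j ->
  [/\ wdiag (erase_cword X (CWord c2)) = wdiag (erase_cword X (CWord c1)),
      wdiag (erase_cword X (CWord c3)) = wdiag (erase_cword X (CWord c1)),
      wdiag (erase_cword X (CWord c4)) = wdiag (erase_cword X (CWord c1)) &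
      fourT (wdiag (erase_cword Y (CWord c1)) - wdiag (erase_cword Y (CWord c2))
       + wdiag (erase_cword Y (CWord c3)) - wdiag (erase_cword Y (CWord c4)))].
  move=> Xj Yi Yj; have [|e1 e2] := same X; first by rewrite Xj orbT.
  by split; [rewrite e1|rewrite (same2 X)|rewrite -e2 (same2 X)|exact: fourT_erase].
(* The argument of [f] loses [~: H], that of [g] loses [H]. So [f] sees the relation when both
   chords are in [H], [g] when neither is; in the mixed cases the first two terms cancel, and so do
   the last two. *)
have [Hi|Hi] := boolP (i' \in H); have [Hj|Hj] := boolP (j' \in H).
- have [|||-> -> -> /hf] := both (labels H) (labels (~: H)%SET);
    rewrite ?Li ?Lj ?inE ?Hi ?Hj //.
  by rewrite linearB linearD linearB -mulrBl -mulrDl -mulrBl => ->; rewrite mul0r !mulr0.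
- have [|-> ->] := same (labels H); first by rewrite Li Hi.
  have [|-> ->] := same (labels (~: H)%SET); first by rewrite Lj inE Hj orbT.
  by rewrite subrr add0r subrr !mulr0.
- have [|-> ->] := same (labels H); first by rewrite Lj Hj orbT.
  have [|-> ->] := same (labels (~: H)%SET); first by rewrite Li inE Hi.
  by rewrite subrr add0r subrr !mulr0.
- have [|||-> -> -> /hg] := both (labels (~: H)%SET) (labels H);
    rewrite ?Li ?Lj ?inE ?Hi ?Hj //.
  by rewrite linearB linearD linearB -mulrBr -mulrDr -mulrBr => ->; rewrite !mulr0.
Qed.

(** * Chord diagrams of resolutions *)

(** [unbump] undoes [lift], by which [resolves] renumbers the double points. *)
Lemma relabel_pred1 (i x : nat) : relabel (pred1 i) x = unbump i x.
Proof.
rewrite /relabel /unbump -[X in (X - _)%N](size_iota 0 x).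
rewrite -(count_predC (pred1 i) (iota 0 x)) count_uniq_mem ?iota_uniq //.
by rewrite mem_iota add0n leq0n addnC addnK.
Qed.

(** The second removal reads labels already renumbered by the first, so [Y] is pulled back along
    [relabel X]. *)
Lemma erase_erase (X Y : pred nat) (s : seq nat) :
  erase Y (erase X s) = erase (fun x => X x || Y (relabel X x)) s.
Proof.
set Z : pred nat := fun x => _.
have rZ x : relabel Y (relabel X x) = relabel Z x.
  rewrite {1}/relabel -erase_iota /erase count_map count_filter.
  by apply: eq_count => y /=; rewrite negb_or andbC.
rewrite /erase filter_map -map_comp -filter_predI.
rewrite (@eq_filter _ _ (fun x => ~~ Z x)); last first.
  by move=> x /=; rewrite negb_or andbC.
by apply: eq_map => x /=; rewrite rZ.
Qed.

(** Fits one step of [resolves_set] to [erase_erase]. Numbers out of range are checked separately,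
    as the predicates live on all of [nat]. *)
Lemma labels_lift (n : nat) (i : 'I_n.+1) (S : {set 'I_n}) :
  labels (i |: [set lift i j | j in S])%SET =1
  (fun x => pred1 (val i) x || labels S (relabel (pred1 (val i)) x)).
Proof.
move=> x; rewrite relabel_pred1.
have [xn|nx] := ltnP x n.+1; last first.
  rewrite labels_ge //= gtn_eqF ?(leq_trans _ nx) // labels_ge //.
  by rewrite /unbump (leq_trans (ltn_ord i) nx) subn1 -ltnS (leq_trans nx) ?leqSpred.
rewrite -[x]/(val (Ordinal xn)); move: (Ordinal xn) => {xn}x.
rewrite labelsE !inE /=; case: (unliftP i x) => [j|] ->; last by rewrite !eqxx.
rewrite eq_sym (negbTE (neq_lift i j)) -[_ == _ :> nat]/(lift i j == i).
rewrite eq_sym (negbTE (neq_lift i j)) /= bumpK labelsE.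
by rewrite mem_imset //; apply: lift_inj.
Qed.

Lemma filter_predC1_enum_ord (n : nat) (i : 'I_n.+1) :
  [seq j <- enum 'I_n.+1 | j != i] = [seq lift i j | j <- enum 'I_n].
Proof.
apply: (inj_map val_inj); rewrite -[LHS](filter_map val (fun x => x != i :> nat)).
rewrite val_enum_ord -map_comp; apply: (@irr_sorted_eq _ ltn).
- exact: ltn_trans.
- exact: ltnn.
- by apply: sorted_filter; [exact: ltn_trans|exact: iota_ltn_sorted].
- rewrite (map_comp (bump i) val) val_enum_ord.
  rewrite sorted_map; apply: sub_sorted (iota_ltn_sorted 0 n) => x y /=.
  by rewrite [in X in _ -> X]ltnNge leq_bump2 -ltnNge.
move=> x; rewrite mem_filter mem_iota /= add0n.
apply/andP/mapP => [[xi xn]|[j _ ->]]; last first.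
  by split; [rewrite -[_ == _]/(lift i j == i) eq_sym neq_lift|exact: ltn_ord].
have /unlift_some[j e _] : i != Ordinal xn by rewrite eq_sym.
by exists j; rewrite ?mem_enum // -[LHS]/(val (Ordinal xn)) e.
Qed.

(** The surviving parameters are unchanged, so erasing a label amounts to filtering the pairs before
    sorting; renumbering does not touch the sort keys. *)
Lemma knot_word_erase (R : realType) (n : nat) (K : sknot R n.+1) (i : 'I_n.+1)
    (K' : sknot R n) :
  (forall j, lo K' j = lo K (lift i j)) ->
  (forall j, hi K' j = hi K (lift i j)) ->
  knot_word K' = erase (pred1 (val i)) (knot_word K).
Proof.
move=> elo ehi; rewrite /knot_word /erase filter_map.
set le := (fun x y : R * nat => x.1 <= y.1).
have le_tot : total le by move=> x y; exact: le_total.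
have le_tr : transitive le by move=> y x z; exact: le_trans.
rewrite filter_sort //.
set f := fun x : R * nat => (x.1, relabel (pred1 (val i)) x.2).
have half (h : 'I_n -> R) (k : 'I_n.+1 -> R) :
    (forall j, h j = k (lift i j)) ->
    [seq (h j, val j) | j <- enum 'I_n] =
    [seq f x | x <- [seq x <- [seq (k j, val j) | j <- enum 'I_n.+1] |
                      preim snd (fun x => ~~ pred1 (val i) x) x]].
  move=> e; rewrite filter_map (@eq_filter _ _ (fun j => j != i)) //.
  rewrite filter_predC1_enum_ord -!map_comp; apply: eq_map => j /=.
  by rewrite /f /= relabel_pred1 bumpK e.
rewrite filter_cat (half _ _ elo) (half _ _ ehi) -map_cat.
by rewrite sort_map -!map_comp; apply: eq_map => x.
Qed.

Lemma resolves_knot_word (R : realType) (n : nat) (K : sknot R n.+1)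
    (i : 'I_n.+1) (pos : bool) (K' : sknot R n) :
  resolves K i pos K' -> knot_word K' = erase (pred1 (val i)) (knot_word K).
Proof.
move=> [phi [nu [a [b [F [_ _ _ /(_ 1) H <-]]]]]].
by have [|_ elo ehi] := H; [rewrite ltr01 lexx|exact: knot_word_erase].
Qed.

Lemma erase_labels0 (n : nat) (w : seq nat) :
  erase (labels (@finset.set0 'I_n)) w = w.
Proof.
have l0 x : labels (@finset.set0 'I_n) x = false.
  by apply/negbTE/negP => /existsP[y]; rewrite inE.
rewrite (@eq_erase _ pred0) // /erase (@eq_filter _ _ predT) // filter_predT.
rewrite -[RHS]map_id; apply: eq_map => x.
by rewrite /relabel (@eq_count _ _ predT) // count_predT size_iota.
Qed.

Lemma resolves_set_knot_word (R : realType) (pos : bool) (n m : nat)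
    (K : sknot R n) (S : {set 'I_n}) (K' : sknot R m) :
  resolves_set pos K S K' -> knot_word K' = erase (labels S) (knot_word K).
Proof.
elim=> {n m K S K'} [n K|n m K i K' S K'' /resolves_knot_word e _ ->].
  by rewrite erase_labels0.
by rewrite e erase_erase; apply/esym/eq_erase/labels_lift.
Qed.

(** Induction on [#|S|]: resolve at one element, then at the others in their new numbering, which
    form the preimage [S'] of [S] under [lift i]. *)
Lemma resolves_set_exists (R : realType) (pos : bool) :
  (forall n (K : sknot R n.+1) i, exists K', resolves K i pos K') ->
  forall n m (K : sknot R n) (S : {set 'I_n}), n = (m + #|S|)%N ->
  exists K' : sknot R m, resolves_set pos K S K'.
Proof.
move=> ex n m K S; move: {2}#|S| (erefl #|S|) => k.
elim: k n K S => [|k IH] n K S sS.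
  move/eqP: (sS); rewrite cards_eq0 => /eqP S0; rewrite sS addn0 => nm.
  by subst n S; exists K; exact: resolves_none.
have /card_gt0P[i iS] : (0 < #|S|)%N by rewrite sS.
case: n K S i sS iS => [|n] K S i sS iS; first by case: i {iS}.
rewrite sS addnS => -[nm].
pose S' := (lift i @^-1: S)%SET.
have ES : S = (i |: [set lift i j | j in S'])%SET.
  apply/setP => x; rewrite !inE; case: (unliftP i x) => [j|] ->.
    rewrite eq_sym (negbTE (neq_lift i j)) /= mem_imset ?inE //.
    exact: lift_inj.
  by rewrite eqxx iS.
have sS' : #|S'| = k.
  have : #|S| = #|S'|.+1.
    rewrite {1}ES cardsU1 card_imset; last exact: lift_inj.
    case: imsetP => [[j _ /eqP]|//]; first by rewrite (negbTE (neq_lift i j)).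
  by rewrite sS => -[].
have [K1 r1] := ex n K i.
have [|K2 r2] := IH n K1 S' sS'; first by rewrite sS'.
by exists K2; rewrite ES; exact: resolves_more r1 r2.
Qed.

(** * Smooth functions and bumps *)

(** Avoids formulas for higher derivatives: the iterated derivatives never leave a class closed
    under derivation. *)
Lemma smooth_coind (R : realType) (V : normedModType R) (S : (R -> V) -> Prop) :
  (forall f, S f -> exists2 df, S df & forall x : R, is_derive x 1 f (df x)) ->
  forall f, S f -> smooth f.
Proof.
move=> SD f Sf k.
have SE g : S g -> S (derive1 g).
  move=> /SD[dg Sdg gd]; rewrite (_ : derive1 g = dg) //.
  by apply/funext => x; rewrite derive1E; exact: derive_val.
have : S (derive1n k f) by elim: k => [//|k IH]; rewrite derive1nS; exact: SE.
by move=> /SD[dg _ gd] x; exact: ex_derive.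
Qed.

Lemma smooth_is_derive (R : realType) (V : normedModType R) (f : R -> V) (x : R) :
  smooth f -> is_derive x 1 f (derive1 f x).
Proof. by move=> sf; rewrite derive1E; apply/derivableP/(sf 0%N). Qed.

Lemma smooth_derive1 (R : realType) (V : normedModType R) (f : R -> V) :
  smooth f -> smooth (derive1 f).
Proof. by move=> sf k x; rewrite -derive1Sn; exact: sf. Qed.

Lemma smooth_scale (R : realType) (c : R) (f : R -> R) :
  smooth f -> smooth (fun x => c * f x).
Proof.
move=> sf; pose S (h : R -> R) := exists2 f : R -> R, smooth f & h = (fun x => c * f x).
apply: (@smooth_coind _ _ S); last by exists f.
move=> _ {f sf} [f sf ->]; exists (fun x => c * derive1 f x).
  by exists (derive1 f) => //; exact: smooth_derive1.
by move=> x; apply: (is_deriveZ c); exact: smooth_is_derive.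
Qed.

Lemma is_derive1_linear_mx (R : realType) (m n : nat) (g : R -> 'M[R]_(m, n))
    (x : R) (dg : 'M[R]_(m, n)) (p : nat) (B : 'M[R]_(n, p)) (i : 'I_m) (j : 'I_p) :
  is_derive x 1 g dg -> is_derive x 1 (fun x => (g x *m B) i j) ((dg *m B) i j).
Proof.
move=> gd; have dg_x := @ex_derive _ _ _ _ _ _ _ gd.
have -> : (fun x => (g x *m B) i j) =
          \sum_(k < n) (fun x => B k j *: (g x i k : R^o)).
  by apply/funext => y; rewrite mxE fct_sumE; apply: eq_bigr => k _; rewrite mulrC.
rewrite mxE; apply: is_derive_eq.
  apply: is_derive_sum => k; apply: is_deriveZ; apply: derivableP.
  by move/derivable_mxP: dg_x; exact.
apply: eq_bigr => k _; rewrite mulrC; congr (_ * _).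
by rewrite -(@derive_val _ _ _ _ _ _ _ gd) derive_mx // mxE.
Qed.

Lemma is_derive1_scale_mx (R : realType) (m n : nat) (f : R -> R) (x df : R)
    (A : 'M[R]_(m, n)) :
  is_derive x 1 f df -> is_derive x 1 (fun x => f x *: A) (df *: A).
Proof.
move=> fd; have fx := @ex_derive _ _ _ _ _ _ _ fd.
have d i j : is_derive x 1 (fun y => (f y *: A) i j) (df * A i j).
  rewrite (_ : (fun _ => _) = (A i j \*: (f : R -> R^o))); last first.
    by apply/funext => y; rewrite mxE mulrC.
  by rewrite mulrC; apply: is_deriveZ.
have dm : derivable (fun x => f x *: A) x 1.
  by apply/derivable_mxP => i j; exact: ex_derive.
apply: DeriveDef => //; rewrite derive_mx //.
by apply/matrixP => i j; rewrite !mxE; exact: derive_val.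
Qed.

Lemma smooth_push (R : realType) (m n : nat) (g : R -> 'M[R]_(m, n))
    (phi : R -> R) (A : 'M[R]_(m, n)) :
  smooth g -> smooth phi -> smooth (fun x => g x + phi x *: A).
Proof.
move=> sg sphi.
pose S (h : R -> 'M[R]_(m, n)) := exists (g : R -> 'M[R]_(m, n)) (phi : R -> R),
  [/\ smooth g, smooth phi & h = fun x => g x + phi x *: A].
apply: (@smooth_coind _ _ S); last first.
  by exists g, phi.
move=> _ {g phi sg sphi} [g [phi [sg sphi ->]]].
exists (fun x => derive1 g x + derive1 phi x *: A).
  by exists (derive1 g), (derive1 phi); split; [exact: smooth_derive1|exact: smooth_derive1|].
move=> x; apply: is_deriveD; first exact: smooth_is_derive.
by apply: is_derive1_scale_mx; apply: smooth_is_derive.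
Qed.

Lemma periodic1_int (R : realType) (V : Type) (f : R -> V) (k : int) (x : R) :
  periodic1 f -> f (x + k%:~R) = f x.
Proof.
move=> pf; have pn (n : nat) y : f (y + n%:R) = f y.
  by elim: n y => [|n IH] y; rewrite ?addr0 // -natr1 addrA pf.
by case: k => n; [exact: pn|rewrite NegzE mulrNz -{2}[x](subrK n.+1%:R) pn].
Qed.

Lemma periodic1_derive1 (R : realType) (V : normedModType R) (f : R -> V) :
  periodic1 f -> periodic1 (derive1 f).
Proof.
move=> pf x; rewrite /derive1.
by under [in LHS]eq_fun do rewrite addrA !pf.
Qed.

(** A zero of a nonnegative function is a minimum. This is how a push by [phi] is seen to change no
    tangent where [phi] vanishes. *)
Lemma derive1_eq0_min (R : realType) (f : R -> R) (x : R) :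
  smooth f -> (forall y, 0 <= f y) -> f x = 0 -> derive1 f x = 0.
Proof.
move=> sf f0 fx; rewrite derive1E.
suff d : is_derive x 1 f 0 by exact: (@derive_val _ _ _ _ _ _ _ d).
apply: (@derive1_at_min _ f (x - 1) (x + 1)).
- by rewrite lerD2l; lra.
- by move=> t _; exact: (sf 0%N).
- by rewrite in_itv /=; apply/andP; split; lra.
- by move=> t _; rewrite fx.
Qed.

(** The classical function exp(-1/t), extended by zero, with the factors 1/t that derivation
    produces. *)
Definition flat (R : realType) (k : nat) (t : R) : R :=
  if 0 < t then t^-1 ^+ k * expR (- t^-1) else 0.

(** The difference quotient at 0 is at most [C] times the absolute value of [h]. The proof divides
    by [|C| + 1], which is positive in any case. *)
Lemma is_derive_flat_at0 (R : realType) (f : R -> R) (C : R) :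
  (forall h, `|f h| <= C * h ^+ 2) -> is_derive (0 : R) 1 f 0.
Proof.
move=> fC; have f0 : f 0 = 0.
  by apply/eqP; rewrite -normr_le0 (le_trans (fC 0)) // expr0n mulr0.
have C1 : 0 < `|C| + 1 by rewrite ltr_wpDl.
have cv : ((fun h => h^-1 *: (f (h *: 1 + 0) - f 0)) @ 0^' --> (0 : R))%classic.
  apply/cvgrPdist_lt => e e0; near=> h.
  have h0 : h != 0 by near: h; exact: nbhs_dnbhs_neq.
  rewrite sub0r normrN f0 subr0 addr0 /GRing.scale /= mulr1 normrM normfV.
  rewrite ltr_pdivrMl ?normr_gt0 // (le_lt_trans (fC h)) //.
  have -> : h ^+ 2 = `|h| * `|h| by rewrite -normrM -expr2 ger0_norm ?sqr_ge0.
  rewrite mulrCA ltr_pM2l ?normr_gt0 //.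
  apply: (@le_lt_trans _ _ ((`|C| + 1) * `|h|)).
    by apply: ler_wpM2r => //; rewrite (le_trans (ler_norm C)) // lerDl.
  rewrite mulrC -ltr_pdivlMr //.
  near: h; apply: dnbhs0_lt; exact: divr_gt0.
apply: DeriveDef; first by apply/cvg_ex; exists 0.
exact: (@cvg_lim _ (@norm_hausdorff _ _)).
Unshelve. all: by end_near. Qed.

(** With s = 1/t, the single term s^(k+2)/(k+2)! of the exponential series is at most exp(s); this
    leaves two powers of t to spare. *)
Lemma flat_le (R : realType) (k : nat) (t : R) : `|flat k t| <= k.+2`!%:R * t ^+ 2.
Proof.
rewrite /flat; case: ifP => t0; last by rewrite normr0 mulr_ge0 ?sqr_ge0.
have u0 : 0 < t^-1 by rewrite invr_gt0.
rewrite ger0_norm; last by rewrite mulr_ge0 ?exprn_ge0 ?expR_ge0 // ltW.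
rewrite expRN ler_pdivrMr ?expR_gt0 //.
have H : t^-1 ^+ k.+2 / k.+2`!%:R <= expR t^-1.
  by apply: le_trans (expR_ge1Dxn k.+1 (ltW u0)); rewrite lerDr.
rewrite ler_pdivrMr ?ltr0n ?fact_gt0 // in H.
rewrite mulrAC -ler_pdivrMr ?exprn_gt0 // [leRHS]mulrC; apply: le_trans H.
by rewrite -exprVn -exprD addn2.
Qed.

Lemma is_derive_flat (R : realType) (k : nat) (t : R) :
  is_derive t 1 (flat k) (- k%:R * flat k.+1 t + flat k.+2 t).
Proof.
have [t0|t0|<-] := ltgtP 0 t.
- apply: (@near_eq_is_derive _ _ _ (fun s : R => s^-1 ^+ k * expR (- s^-1))).
    near=> s; rewrite /flat ifT //.
    by near: s; exact: lt_nbhsr.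
  have iv : is_derive t 1 (fun s : R => s^-1) (- t^-1 ^+ 2).
    apply: is_derive_eq; first by apply: is_deriveV; rewrite gt_eqF.
    by rewrite exprVn /GRing.scale /= mulr1.
  have ie : is_derive t 1 (fun s : R => expR (- s^-1)) (expR (- t^-1) * t^-1 ^+ 2).
    rewrite -[X in _ * X]opprK.
    exact: (is_derive1_comp (f := expR) (g := fun s : R => - s^-1)
      (is_derive_expR _) (is_deriveN (f := fun s : R => s^-1) iv)).
  have d := is_deriveM (is_deriveX k iv) ie; rewrite exprfctE in d.
  apply: (is_derive_eq d); rewrite /flat t0 /GRing.scale /=.
  case: {d} k => [|k] /=; first by rewrite !expr0; ring.
  by rewrite !exprS; ring.
- apply: (@near_eq_is_derive _ _ _ (cst 0)).
    near=> s; rewrite /flat ifF //; apply/negbTE; rewrite -leNgt ltW //.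
    by near: s; exact: lt_nbhsl.
  rewrite /flat !ltNge (ltW t0) /= mulr0 addr0; exact: is_derive_cst.
- rewrite /flat ltxx mulr0 addr0; exact: is_derive_flat_at0 (@flat_le R k).
Unshelve. all: by end_near. Qed.

(* A class of functions closed under derivation: the derivative of [flat k] is
   [- k * flat k.+1 + flat k.+2]. *)
Inductive bump_algebra (R : realType) (t0 c : R) : (R -> R) -> Prop :=
| bump_cst a : bump_algebra t0 c (cst a)
| bump_cos : bump_algebra t0 c (fun x => cos ((trigo.pi *+ 2) * (x - t0)))
| bump_sin : bump_algebra t0 c (fun x => sin ((trigo.pi *+ 2) * (x - t0)))
| bump_flat k :
    bump_algebra t0 c (fun x => flat k (cos ((trigo.pi *+ 2) * (x - t0)) - c))
| bump_add f g :
    bump_algebra t0 c f -> bump_algebra t0 c g -> bump_algebra t0 c (f + g)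
| bump_mul f g :
    bump_algebra t0 c f -> bump_algebra t0 c g -> bump_algebra t0 c (f * g).

Lemma bump_algebra_smooth (R : realType) (t0 c : R) (f : R -> R) :
  bump_algebra t0 c f -> smooth f.
Proof.
apply: smooth_coind => {}f; set T : R := trigo.pi *+ 2.
have da (x : R) : is_derive x 1 (fun x => T * (x - t0)) T.
  have d := is_deriveZ T (is_deriveB (is_derive_id x 1) (is_derive_cst t0 x 1)).
  by apply: (is_derive_eq d); rewrite /GRing.scale /= subr0 mulr1.
have dcos (x : R) : is_derive x 1 (fun x => cos (T * (x - t0))) (- T * sin (T * (x - t0))).
  rewrite mulNr mulrC -mulNr; exact: is_derive1_comp (is_derive_cos _) (da x).
have dsin (x : R) : is_derive x 1 (fun x => sin (T * (x - t0))) (T * cos (T * (x - t0))).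
  rewrite mulrC; exact: is_derive1_comp (is_derive_sin _) (da x).
elim=> [a|||k|{}f g _ [df bf fd] _ [dg bg gd]|{}f g Bf [df bf fd] Bg [dg bg gd]].
- by exists (cst 0); [exact: bump_cst|move=> x; exact: is_derive_cst].
- exists (cst (- T) * (fun x => sin (T * (x - t0)))); last exact: dcos.
  by apply: bump_mul; [exact: bump_cst|exact: bump_sin].
- exists (cst T * (fun x => cos (T * (x - t0)))); last exact: dsin.
  by apply: bump_mul; [exact: bump_cst|exact: bump_cos].
- exists ((cst (- k%:R) * (fun x => flat k.+1 (cos (T * (x - t0)) - c))
     + (fun x => flat k.+2 (cos (T * (x - t0)) - c)))
     * (cst (- T) * (fun x => sin (T * (x - t0))))).
    apply: bump_mul; last first.
      by apply: bump_mul; [exact: bump_cst|exact: bump_sin].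
    apply: bump_add; last exact: bump_flat.
    by apply: bump_mul; [exact: bump_cst|exact: bump_flat].
  move=> x; have d := is_deriveB (dcos x) (is_derive_cst c x 1).
  rewrite subr0 in d; exact: is_derive1_comp (is_derive_flat k _) d.
- by exists (df + dg); [exact: bump_add|move=> x; exact: is_deriveD].
- exists (f * dg + g * df); last by move=> x; exact: is_deriveM.
  by apply: bump_add; exact: bump_mul.
Qed.

(** Applying [flat 0] to cos(2 pi (x - t0)) - cos(2 pi delta) makes the bump periodic at once. Its
    support is as wanted because cos decreases on [0, pi], and [delta] below 1/2 keeps 2 pi delta in
    that interval. *)
Lemma bump_exists (R : realType) (t0 delta : R) : 0 < delta < 2^-1 ->
  exists phi : R -> R,
    [/\ smooth phi, periodic1 phi, forall x, 0 <= phi x <= 1, 0 < phi t0 &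
        forall x, phi x != 0 -> exists k : int, `|x + k%:~R - t0| < delta].
Proof.
move=> /andP[d0 d2]; set T : R := trigo.pi *+ 2.
have pi0 : 0 < trigo.pi :> R := pi_gt0 R.
have T0 : 0 < T by rewrite pmulrn_lgt0.
have TE (x : R) : T * x = trigo.pi * (x *+ 2) by rewrite mulrnAl mulrnAr.
have itv (x : R) : 0 <= x <= 2^-1 -> T * x \in `[0, trigo.pi].
  move=> /andP[x0 x2]; rewrite in_itv /= TE mulr_ge0 ?(ltW pi0) ?mulrn_wge0 //=.
  by rewrite ger_pMr // -mulr_natr; lra.
have per : periodic1 (fun x : R => cos (T * x)).
  by move=> x; rewrite mulrDr mulr1 cosD2pi.
pose phi x := flat 0 (cos (T * (x - t0)) - cos (T * delta)).
have gt0 x : (0 < phi x) = (cos (T * delta) < cos (T * (x - t0))).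
  rewrite /phi /flat expr0 mul1r -[RHS]subr_gt0; case: ifP => //.
  by rewrite expR_gt0.
exists phi; split.
- by apply: (@bump_algebra_smooth _ t0 (cos (T * delta))); exact: bump_flat.
- by move=> x; rewrite /phi addrAC per.
- move=> x; rewrite /phi /flat expr0 mul1r; case: ifP => h; last by rewrite lexx ler01.
  by rewrite expR_ge0 expR_le1 oppr_le0 invr_ge0 ltW.
- rewrite gt0 subrr mulr0 cos0 -cos0 ltr_cos ?mulr_gt0 ?itv ?(ltW d0) ?(ltW d2) //.
  by rewrite in_itv /= lexx (ltW pi0).
move=> x phx; have {phx} : 0 < phi x.
  rewrite lt_neqAle eq_sym phx /phi /flat /=; case: ifP => h; last exact: lexx.
  by rewrite mulr_ge0 ?exprn_ge0 ?invr_ge0 ?expR_ge0 // ltW.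
(* [k] is an integer nearest to [z], at distance at most 1/2. *)
rewrite gt0; set z := x - t0; pose k := Num.floor (z + 2^-1).
have := floor_itv (z + 2^-1); rewrite -/k rmorphD /= => /andP[k1 k2].
rewrite -(periodic1_int (- k) z per); set y := z + _.
have -> : cos (T * y) = cos (T * `|y|).
  by have [y0|y0] := ger0P y; rewrite // mulrN cosN.
have yE : y = z - k%:~R by rewrite /y mulrNz.
rewrite ltr_cos ?itv ?(ltW d0) ?(ltW d2) ?normr_ge0 ?ler_norml //; last first.
  by apply/andP; split; lra.
rewrite ltr_pM2l // => yd; exists (- k); apply: le_lt_trans yd.
by rewrite /y /z addrAC.
Qed.

(** * Existence of resolutions *)

Lemma det3Z (R : realType) (a b nu : 'rV[R]_3) (c : R) :
  det3 a b (c *: nu) = c * det3 a b nu.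
Proof.
rewrite /det3; set M := col_mx a (col_mx b nu).
have -> : col_mx a (col_mx b (c *: nu)) =
    block_mx (1%:M : 'M[R]_1) 0 0 (block_mx (1%:M : 'M[R]_1) 0 0 (c%:M : 'M[R]_1)) *m M.
  by rewrite /M !mul_block_col !mul1mx !mul0mx !addr0 !add0r mul_scalar_mx.
by rewrite det_mulmx (@det_ublock _ 1 2) (@det_ublock _ 1 1) !det1 !mul1r det_scalar1.
Qed.

(** Some standard basis vector [nu] lies outside the plane of [a] and [b]; then [u] and [w] are the
    first two vectors of the basis dual to [a], [b], [nu]. *)
Lemma transverse_frame (R : realType) (a b : 'rV[R]_3) : row_free (col_mx a b) ->
  exists (nu : 'rV[R]_3) (u w : 'cV[R]_3),
    [/\ (a *m u = 1%:M /\ b *m u = 0), (a *m w = 0 /\ b *m w = 1%:M),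
        (nu *m u = 0 /\ nu *m w = 0) & det3 a b nu != 0].
Proof.
move=> fab.
have /row_subPn[i] : ~~ ((1%:M : 'M[R]_3) <= col_mx a b)%MS.
  apply/negP => /mxrankS; rewrite mxrank1 => /(leq_trans)/(_ (rank_leq_row _)).
  by [].
set nu := row i _ => nab.
pose M : 'M[R]_3 := col_mx a (col_mx b nu).
have uM : M \in unitmx.
  rewrite -row_free_unit; apply: inj_row_free => v.
  rewrite -[v](@hsubmxK _ 1 1 2); set x := lsubmx _; set y := rsubmx _.
  rewrite -[y](@hsubmxK _ 1 1 1); set z := lsubmx _; set t := rsubmx _.
  rewrite /M (@mul_row_col _ 1 1 2 3) (@mul_row_col _ 1 1 1 3) => e.
  (* A nonzero coefficient of [nu] would put [nu] into the span of [a] and [b]. *)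
  have t0 : t = 0.
    apply/eqP/negP => /negP tn0; case/negP: nab.
    have tE : t = (t 0 0)%:M := mx11_scalar t.
    have t00 : t 0 0 != 0.
      by apply/negP => /eqP z0; case/eqP: tn0; rewrite tE z0 -scalemx1 scale0r.
    have -> : nu = (t 0 0)^-1 *: (row_mx (- x) (- z) *m col_mx a b).
      rewrite mul_row_col !mulNmx -opprD.
      have -> : - (x *m a + z *m b) = t *m nu.
        by move/eqP: e; rewrite addrA addr_eq0 => /eqP ->; rewrite opprK.
      by rewrite (_ : t *m nu = t 0 0 *: nu) ?scalerA ?mulVf ?scale1r // {1}tE mul_scalar_mx.
    by rewrite scalemx_sub // submxMl.
  move: e; rewrite t0 mul0mx addr0 -mul_row_col => /eqP.
  rewrite (mulmx_free_eq0 _ fab) => /eqP e.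
  have [-> ->] := eq_row_mx (etrans e (esym (row_mx0 _ _ _ _))).
  by rewrite !row_mx0.
pose u := invmx M *m col_mx (1%:M : 'M[R]_1) (0 : 'M[R]_(2, 1)).
pose w := invmx M *m col_mx (0 : 'M[R]_1) (col_mx (1%:M : 'M[R]_1) (0 : 'M[R]_1)).
exists nu, u, w.
have : M *m u = col_mx (1%:M : 'M[R]_1) (col_mx (0 : 'M[R]_1) (0 : 'M[R]_1)).
  by rewrite mulKVmx // col_mx0.
have : M *m w = col_mx (0 : 'M[R]_1) (col_mx (1%:M : 'M[R]_1) (0 : 'M[R]_1)) by rewrite mulKVmx.
rewrite /M !(@mul_col_mx _ 1 2 3 1) !(@mul_col_mx _ 1 1 3 1)
  => /(@eq_col_mx _ 1 2 1)[aw /(@eq_col_mx _ 1 1 1)[bw nw]]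
  /(@eq_col_mx _ 1 2 1)[au /(@eq_col_mx _ 1 1 1)[bu nu0]].
by split=> //; rewrite -unitfE -unitmxE.
Qed.

(** Strict differentiability, needed because both points move. The continuous derivative stays
    within [e] of [c] near [t], and the mean value theorem applies between [x] and [y]. *)
Lemma linear_coord_strict_derive (R : realType) (n : nat) (g : R -> 'rV[R]_n)
    (u : 'cV[R]_n) (t c e : R) :
  smooth g -> (derive1 g t *m u) 0 0 = c -> 0 < e ->
  exists2 r : R, 0 < r & forall x y, `|x - t| < r -> `|y - t| < r ->
    `|(g x *m u) 0 0 - (g y *m u) 0 0 - c * (x - y)| <= e * `|x - y| /\
    `|(derive1 g x *m u) 0 0 - c| < e.
Proof.
move=> sg <- e0; pose f (x : R) : R := (g x *m u) 0 0.
pose f' (x : R) : R := (derive1 g x *m u) 0 0.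
have fd (x : R) : is_derive x 1 f (f' x).
  exact/is_derive1_linear_mx/smooth_is_derive.
have f'c : (f' x @[x --> t] --> f' t)%classic.
  apply: differentiable_continuous; apply/derivable1_diffP.
  apply: (@ex_derive _ _ _ _ _ _ _ (is_derive1_linear_mx _ _ _ _)).
  exact/smooth_is_derive/smooth_derive1.
have /nbhs_ballP[r /= r0 rP] : nbhs t (f' @^-1` ball (f' t) e)%classic.
  by apply: f'c; exact: nbhsx_ballx.
have ballE (a b d : R) : ball a d b = (`|b - a| < d) :> Prop.
  by rewrite -ball_normE /= distrC.
have {}rP x : `|x - t| < r -> `|f' x - f' t| < e.
  by rewrite -!ballE; exact: rP.
exists r => // x y xr yr; split; last exact: rP.
rewrite -/(f x) -/(f y) -/(f' t).
wlog xy : x y xr yr / y <= x.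
  move=> H; have [|xy] := leP y x; first exact: H.
  have := H _ _ yr xr (ltW xy); rewrite [`|y - x|]distrC; congr (_ <= _).
  by rewrite -normrN; congr `|_|; ring.
have fc : {within `[y, x], continuous f}%classic.
  by apply: derivable_within_continuous => z _; exact: (@ex_derive _ _ _ _ _ _ _ (fd z)).
have [z] := MVT_segment xy (fun z _ => fd z) fc.
rewrite in_itv /= => /andP[yz zx] ->; rewrite -mulrBl normrM.
apply: ler_wpM2r => //; apply/ltW/rP.
by move: xr yr; rewrite !ltr_norml => /andP[? ?] /andP[? ?]; apply/andP; split; lra.
Qed.

(** The parameters in [0, 1] away from both preimages have a compact image missing the double point,
    hence at a positive distance from it. *)
Lemma far_from_double_point (R : realType) (n : nat) (K : sknot R n) (i : 'I_n) (r : R) :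
  0 < r -> exists2 m : R, 0 < m &
    forall y, `|curve K y - curve K (lo K i)| < m ->
    exists k : int, `|y + k%:~R - lo K i| < r \/ `|y + k%:~R - hi K i| < r.
Proof.
move=> r0; set g := curve K; set t0 := lo K i; set t1 := hi K i.
have pg : periodic1 g := @knot_periodic _ _ K.
have [t00 t01 t11] := knot_range K i.
have gt : g t0 = g t1.
  have [_] := @knot_double _ _ K t0 t1 t00 t01 t11.
  by apply; exists i.
(* All integer translates are taken, since nearness of parameters is meant on R/Z. *)
pose U := (\bigcup_(k in [set: int]) (ball (t0 - k%:~R) r `|` ball (t1 - k%:~R) r))%classic.
have UP y : U y -> exists k : int, `|y + k%:~R - t0| < r \/ `|y + k%:~R - t1| < r.
  case=> k _ H; exists k; move: H; rewrite /= -!ball_normE /=.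
  suff E (t : R) : `|y + k%:~R - t| = `|t - k%:~R - y| by rewrite !E.
  by rewrite -normrN; congr `|_|; ring.
have oU : open U by apply: bigcup_open => k _; apply: openU; exact: ball_open.
pose A := (`[0, 1] `&` ~` U)%classic.
have cA : compact A by apply: compact_closedI; [exact: segment_compact|exact: open_closedC].
have cg : continuous g.
  by move=> x; apply/differentiable_continuous/derivable1_diffP/(@knot_smooth _ _ K 0%N).
have cgA : closed (g @` A).
  apply: compact_closed; first exact: norm_hausdorff.
  by apply: continuous_compact => //; exact: continuous_subspaceT.
have ng : ~ (g @` A)%classic (g t0).
  have Ut0 : U t0.
    by exists 0 => //; left; rewrite subr0; exact: ballxx.
  have Ut1 : U t1.
    by exists 0 => //; right; rewrite subr0; exact: ballxx.
  have key y : 0 <= y -> y < 1 -> g y = g t0 -> y = t0 \/ y = t1.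
    move=> y0 y1 gy; have [yt|yt|->] := ltgtP y t0; last by left.
      have [] := @knot_double _ _ K y t0 y0 yt (lt_trans t01 t11).
      by move=> /(_ gy)[j [_ /eqP]]; rewrite (negbTE (knot_lo_hi K i j)).
    have [] := @knot_double _ _ K t0 y t00 yt y1.
    move=> /(_ (esym gy))[j [/(@knot_lo_inj _ _ K) <- ->] _].
    by right.
  case=> y [/=]; rewrite in_itv /= => /andP[y0 y1] nU gy.
  (* The end 1 of the segment is out of reach of [knot_double]; periodicity trades it for 0, and a
     ball indexed by [-1] covers it. *)
  move: y1; rewrite le_eqVlt => /orP[/eqP y1|y1].
    have [] := key 0; rewrite ?lexx ?ltr01 //; first by rewrite -gy y1 -[1]add0r pg.
      by move=> z; apply: nU; rewrite y1; exists (-1) => //; left;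
        rewrite -z mulrNz opprK add0r; exact: ballxx.
    by move=> z; apply: nU; rewrite y1; exists (-1) => //; right;
        rewrite -z mulrNz opprK add0r; exact: ballxx.
  by have [z|z] := key y y0 y1 gy; apply: nU; rewrite z.
have : nbhs (g t0) (~` (g @` A))%classic by apply: open_nbhs_nbhs; split=> //; exact: closed_openC.
move=> /nbhs_ballP[m /= m0 mP]; exists m => // y ym.
pose k := Num.floor y.
have [y0 y1] : 0 <= y - k%:~R /\ y - k%:~R <= 1.
  by have := floor_itv y; rewrite -/k rmorphD /= => /andP[? ?]; split; lra.
have [|l H] := UP (y - k%:~R).
  apply: contrapT => nU; apply: (mP (g (y - k%:~R))).
    by rewrite -ball_normE /= distrC -mulrNz periodic1_int.
  by exists (y - k%:~R) => //; split=> //; rewrite /= in_itv /= y0.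
exists (l - k); move: H; rewrite rmorphB /=.
by rewrite [_ - _ + _]addrAC -![y + _ - _]addrA.
Qed.

(* Both branches are nearly straight near the double point.  In the coordinates
   [u], [w] dual to the two tangents, a point of one branch and a point of the
   other agree only at the double point itself, and two points of the same
   branch differ. *)
Lemma double_point_nbhd (R : realType) (n : nat) (K : sknot R n) (i : 'I_n)
    (u w : 'cV[R]_3) :
  derive1 (curve K) (lo K i) *m u = 1%:M -> derive1 (curve K) (hi K i) *m u = 0 ->
  derive1 (curve K) (lo K i) *m w = 0 -> derive1 (curve K) (hi K i) *m w = 1%:M ->
  exists delta m : R,
    [/\ 0 < delta < 2^-1, 0 < m,
        forall x, `|x - lo K i| < delta -> derive1 (curve K) x *m u != 0,
        forall x y, `|x - lo K i| < delta -> `|y - lo K i| < delta ->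
          curve K x *m u = curve K y *m u -> x = y
      & forall x y, `|x - lo K i| < delta ->
          `|curve K y - curve K x| <= m ->
          curve K x *m u = curve K y *m u -> curve K x *m w = curve K y *m w ->
          (exists k : int, y + k%:~R = x) \/
          (x = lo K i /\ exists k : int, y + k%:~R = hi K i)].
Proof.
set g := curve K; set t0 := lo K i; set t1 := hi K i => au bu aw bw.
have pg : periodic1 g := @knot_periodic _ _ K.
have sg : smooth g := @knot_smooth _ _ K.
have [t00 t01 t11] := knot_range K i.
have gt : g t0 = g t1.
  by have [_] := @knot_double _ _ K t0 t1 t00 t01 t11; apply; exists i.
(* The allowed slope error; for [cross] any value below 1/2 would do. *)
have e0 : 0 < 4^-1 :> R by lra.
have z00 (A : 'M[R]_1) : A = 0 -> A 0 0 = 0 by move=> ->; rewrite mxE.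
have z10 (A : 'M[R]_1) : A = 1%:M -> A 0 0 = 1 by move=> ->; rewrite mxE eqxx.
have [r1 r10 P1] := linear_coord_strict_derive sg (z10 _ au) e0.
have [r2 r20 P2] := linear_coord_strict_derive sg (z00 _ aw) e0.
have [r3 r30 P3] := linear_coord_strict_derive sg (z00 _ bu) e0.
have [r4 r40 P4] := linear_coord_strict_derive sg (z10 _ bw) e0.
have [r r0 rP] : exists2 r, 0 < r &
    forall x, x < r -> [/\ x < r1, x < r2, x < r3 & x < r4].
  exists (Num.min (Num.min r1 r2) (Num.min r3 r4)).
    by rewrite !lt_min r10 r20 r30 r40.
  by move=> x; rewrite !lt_min => /andP[/andP[-> ->] /andP[-> ->]].
have [m m0 mP] := far_from_double_point K i r0.
have gc : (g x @[x --> t0] --> g t0)%classic.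
  by apply/differentiable_continuous/derivable1_diffP/(sg 0%N).
have m20 : 0 < m / 2 by rewrite divr_gt0.
have /nbhs_ballP[d /= d0 dP] : nbhs t0 (g @^-1` ball (g t0) (m / 2))%classic.
  by apply: gc; exact: nbhsx_ballx.
have {}dP x : `|x - t0| < d -> `|g x - g t0| < m / 2.
  by move=> xd; have := dP x; rewrite -!ball_normE /= distrC (distrC (g t0)); exact.
have near x y : `|x - t0| < r -> `|y - t0| < r -> g x *m u = g y *m u -> x = y.
  move=> /rP[x1 _ _ _] /rP[y1 _ _ _] e; have [H _] := P1 x y x1 y1.
  move: H; rewrite e subrr sub0r normrN mul1r => H.
  by apply/eqP; rewrite -subr_eq0 -normr_le0; lra.
have cross x y : `|x - t0| < r -> `|y - t1| < r ->
    g x *m u = g y *m u -> g x *m w = g y *m w -> x = t0 /\ y = t1.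
  move=> /rP[x1 x2 _ _] /rP[_ _ y3 y4] eu ew.
  have z k : 0 < k -> `|t0 - t0| < k /\ `|t1 - t1| < k.
    by move=> k0; rewrite !subrr normr0.
  have [H1 _] := P1 x t0 x1 (z _ r10).1.
  have [H2 _] := P2 x t0 x2 (z _ r20).1.
  have [H3 _] := P3 y t1 y3 (z _ r30).2.
  have [H4 _] := P4 y t1 y4 (z _ r40).2.
  move: H1 H2 H3 H4; rewrite -gt eu ew !mul1r !mul0r !subr0.
  (* The displacements from the double point along [u] and [w]. Seen from the first branch, [A] is
     close to [x - t0] and [B] is small; from the second, [B] is close to [y - t1] and [A] is small.
     So each parameter difference is at most a third of the other. *)
  set A := _ - (g t0 *m u) 0 0; set B := _ - (g t0 *m w) 0 0.
  move=> H1 H2 H3 H4.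
  have h1 : `|x - t0| <= `|A| + `|A - (x - t0)|.
    by rewrite -{1}[x - t0](subKr A) ler_normB.
  have h2 : `|y - t1| <= `|B| + `|B - (y - t1)|.
    by rewrite -{1}[y - t1](subKr B) ler_normB.
  move: H1 H2 H3 H4 h1 h2 (normr_ge0 (x - t0)) (normr_ge0 (y - t1)).
  move: `|A| `|B| `|A - _| `|B - _| => a b a' b' H1 H2 H3 H4 h1 h2 x0 y0.
  by split; apply/eqP; rewrite -subr_eq0 -normr_le0; move: x0 y0 H1 H2 H3 H4 h1 h2;
    move: `|x - t0| `|y - t1| => p q *; lra.
(* The cap 1/4 keeps [delta] below 1/2. Halving [m] leaves room for the distance from [g x] to the
   double point, which [d] keeps below [m / 2]. *)
exists (Num.min (Num.min r d) 4^-1), (m / 2); split=> //.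
- rewrite !lt_min r0 d0 e0 /=; apply: (@le_lt_trans _ _ 4^-1); last by lra.
  by rewrite ge_min lexx orbT.
- move=> x; rewrite !lt_min => /andP[/andP[/rP[x1 _ _ _] _] _].
  have [_ H] := P1 x x x1 x1; apply/negP => /eqP/z00 e.
  by move: H; rewrite e sub0r normrN normr1; lra.
- by move=> x y; rewrite !lt_min => /andP[/andP[xr _] _] /andP[/andP[yr _] _]; exact: near.
move=> x y; rewrite !lt_min => /andP[/andP[xr xd] _] xy eu ew.
have : `|g y - g t0| < m.
  have -> : g y - g t0 = (g y - g x) + (g x - g t0) by rewrite addrA subrK.
  apply: le_lt_trans (ler_normD _ _) _.
  by have := dP x xd; move: xy; set p := `|_|; set q := `|_|; lra.
move=> /mP[k [yk|yk]].
  by left; exists k; apply: near => //; rewrite (periodic1_int _ _ pg).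
right; have [-> yt] : x = t0 /\ y + k%:~R = t1.
  by apply: cross; rewrite ?(periodic1_int _ _ pg).
by split=> //; exists k.
Qed.

Lemma unit_interval_shift (R : realType) (x y : R) (k : int) :
  0 <= x < 1 -> 0 <= y < 1 -> x + k%:~R = y -> x = y.
Proof.
move=> /andP[x0 x1] /andP[y0 y1] e.
suff k0 : k = 0 by rewrite -e k0 addr0.
have : (-1)%:~R < k%:~R :> R by rewrite mulrNz; lra.
have : k%:~R < 1%:~R :> R by lra.
by rewrite !ltr_int; lia.
Qed.

Lemma double_param_itv (R : realType) (n : nat) (K : sknot R n) (y : R) :
  double_param K y -> 0 <= y < 1.
Proof.
case=> i [] ->; have [h1 h2 h3] := knot_range K i.
  by rewrite h1 (lt_trans h2).
by rewrite h3 (le_trans h1) // ltW.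
Qed.

(** The injectivity hypothesis excludes coincidences with [phi] nonzero at one of the parameters.
    The others are double points of [K], not the one labelled [i] as [phi] is positive at [lo K i],
    and their tangents are unchanged. *)
Lemma pushed_sknot (R : realType) (n : nat) (K : sknot R n.+1) (i : 'I_n.+1)
    (phi : R -> R) (nu : 'rV[R]_3) :
  smooth phi -> periodic1 phi -> (forall x, 0 <= phi x) -> 0 < phi (lo K i) ->
  (forall x y, phi x != 0 ->
     curve K x + phi x *: nu = curve K y + phi y *: nu ->
     exists k : int, x + k%:~R = y) ->
  (forall x, phi x != 0 -> derive1 (curve K) x + derive1 phi x *: nu != 0) ->
  (forall y, double_param K y -> phi y != 0 -> y = lo K i) ->
  exists K' : sknot R n,
    [/\ curve K' = (fun x => curve K x + phi x *: nu),
        forall j, lo K' j = lo K (lift i j) & forall j, hi K' j = hi K (lift i j)].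
Proof.
move=> sphi pphi phi0 phit inj imm arc.
set g' := fun x => curve K x + phi x *: nu.
have sg : smooth (curve K) := @knot_smooth _ _ K.
have dg x : derive1 g' x = derive1 (curve K) x + derive1 phi x *: nu.
  rewrite derive1E; apply: (@derive_val _ _ _ _ _ _ _
    (is_deriveD (smooth_is_derive x sg)
      (is_derive1_scale_mx nu (smooth_is_derive x sphi)))).
have dphi x : phi x = 0 -> derive1 phi x = 0 by exact: derive1_eq0_min.
have lo0 j : phi (lo K (lift i j)) = 0.
  apply/eqP; apply: contraT => /arc H.
  have /knot_lo_inj/eqP : lo K (lift i j) = lo K i by apply: H; exists (lift i j); left.
  by rewrite eq_sym (negbTE (neq_lift i j)).
have hi0 j : phi (hi K (lift i j)) = 0.
  apply/eqP; apply: contraT => /arc H.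
  have /esym/eqP : hi K (lift i j) = lo K i by apply: H; exists (lift i j); right.
  by rewrite (negbTE (knot_lo_hi K _ _)).
have lift_i := @lift_inj _ i.
suff dbl x y : 0 <= x -> x < y -> y < 1 ->
    g' x = g' y <-> exists j, x = lo K (lift i j) /\ y = hi K (lift i j).
  have imm' x : derive1 g' x != 0.
    rewrite dg; have [p0|/imm//] := eqVneq (phi x) 0.
    by rewrite dphi // scale0r addr0; exact: knot_immersed.
  have per : periodic1 g'.
    by move=> x; rewrite /g' pphi (@knot_periodic _ _ K).
  have tr j : row_free (col_mx (derive1 g' (lo K (lift i j)))
                               (derive1 g' (hi K (lift i j)))).
    by rewrite !dg !dphi // !scale0r !addr0; exact: knot_transverse.
  exists (@SKnot R n g' (fun j => lo K (lift i j)) (fun j => hi K (lift i j))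
    (@smooth_push R 1 3 (curve K) phi nu sg sphi) per imm' (fun j => knot_range K (lift i j))
    (inj_comp (@knot_lo_inj _ _ K) lift_i) (inj_comp (@knot_hi_inj _ _ K) lift_i)
    (fun j k => knot_lo_hi K _ _) dbl tr).
  by [].
move=> x0 xy y1; have [dK Kd] := @knot_double _ _ K x y x0 xy y1.
have x1 := lt_trans xy y1; have y0 := le_lt_trans x0 xy.
split; last first.
  case=> j [ex ey]; have [px py] : phi x = 0 /\ phi y = 0 by rewrite ex ey.
  rewrite /g' px py !scale0r !addr0.
  by apply: Kd; exists (lift i j).
have not_shift (k : int) : x + k%:~R <> y.
  move=> /unit_interval_shift e; move: xy; rewrite e ?ltxx //; apply/andP; split=> //.
  exact: ltW.
have [px|px] := eqVneq (phi x) 0; last first.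
  by move=> /(inj _ _ px)[k /not_shift].
have [py|py] := eqVneq (phi y) 0; last first.
  move=> /esym/(inj _ _ py)[k e]; case: (not_shift (- k)).
  by rewrite -e mulrNz addrK.
rewrite /g' px py !scale0r !addr0 => /dK[j [ex ey]].
have [|j' ej _] := @unlift_some _ i j; last by exists j'; rewrite -ej.
by apply/eqP => ij; move: phit; rewrite ij -ex px ltxx.
Qed.

Lemma resolves_exists (R : realType) (n : nat) (K : sknot R n.+1) (i : 'I_n.+1)
    (pos : bool) : exists K', resolves K i pos K'.
Proof.
have [nu0 [u [w [[au bu] [aw bw] [nu0u nu0w] det0]]]] :=
  transverse_frame (knot_transverse K i).
have [delta [m [dlt m0 imm near cross]]] := double_point_nbhd au bu aw bw.
have [phi [sphi pphi phi01 phit phid]] := bump_exists (lo K i) dlt.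
set g := curve K; set t0 := lo K i; set t1 := hi K i.
have [t00 t01 t11] := knot_range K i.
have gt : g t0 = g t1.
  by have [_] := @knot_double _ _ K t0 t1 t00 t01 t11; apply; exists i.
have pg : periodic1 g := @knot_periodic _ _ K.
pose d := det3 (derive1 g t0) (derive1 g t1) nu0.
have nn0 : 0 < `|nu0|.
  rewrite normr_gt0; apply: contra det0 => /eqP ->.
  by rewrite -(scale0r (0 : 'rV_3)) det3Z mul0r.
(* The sign gives the determinant in [resolves] the sign that [pos] asks for; the size gives [nu]
   the norm [m], the largest push that [cross] allows. *)
pose c := (-1) ^+ (~~ pos) * Num.sg d * (m / `|nu0|).
have c0 : c != 0.
  rewrite /c !mulf_eq0 signr_eq0 sgr_eq0 invr_eq0 (gt_eqF m0) (gt_eqF nn0).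
  by rewrite !orbF.
pose nu := c *: nu0.
have nu0' : nu != 0 by rewrite scaler_eq0 negb_or c0 -normr_gt0.
have nuu : nu *m u = 0 by rewrite -scalemxAl nu0u scaler0.
have nuw : nu *m w = 0 by rewrite -scalemxAl nu0w scaler0.
have num : `|nu| <= m.
  rewrite normrZ /c !normrM normr_sign mul1r normr_sg det0 mul1r.
  by rewrite normfV normr_id gtr0_norm // -mulrA mulVf ?mulr1 // gt_eqF.
have phi0 x : 0 <= phi x by case/andP: (phi01 x).
have coord (l x : R) (v : 'cV_3) : nu *m v = 0 -> (g x + (l * phi x) *: nu) *m v = g x *m v.
  by move=> nv; rewrite mulmxDl -scalemxAl nv scaler0 addr0.
(* [cross] is applied to [y] and the other preimage of the same double point, which differs from [y]
   modulo 1. *)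
have arc y (k : int) : double_param K y -> `|y + k%:~R - t0| < delta -> y = t0.
  move=> dy yd; have yI := double_param_itv dy.
  have t0I : 0 <= t0 < 1 by rewrite t00 (lt_trans t01).
  (* [z] is the other preimage of the double point of [y]. *)
  have [z [dz zy gz]] : exists z, [/\ double_param K z, z != y & g z = g y].
    case: dy => j ej; have [j0 j1 j2] := knot_range K j.
    have e : g (lo K j) = g (hi K j).
      by have [_] := @knot_double _ _ K _ _ j0 j1 j2; apply; exists j.
    case: ej => ->; [exists (hi K j)|exists (lo K j)]; split=> //.
    + by exists j; right.
    + by rewrite eq_sym knot_lo_hi.
    + by exists j; left.
    + exact: knot_lo_hi.
  have gzy : curve K z = curve K (y + k%:~R) by rewrite -/g (periodic1_int _ _ pg).
  have [|||[l e]|[e _]] := cross _ z yd; rewrite -?gzy ?subrr ?normr0 ?(ltW m0) //.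
  + case/eqP: zy; apply: (@unit_interval_shift _ _ _ (l - k)) => //.
      exact: double_param_itv dz.
    by rewrite rmorphB /= addrA e addrK.
  + exact: unit_interval_shift e.
(* [resolves] asks for a singular knot at every stage. As [phi] is at most 1, each stage moves
   points by at most [m]. *)
have push lam : 0 < lam <= 1 -> exists K' : sknot R n,
    [/\ curve K' = (fun x => curve K x + (lam * phi x) *: nu),
        forall j, lo K' j = lo K (lift i j) & forall j, hi K' j = hi K (lift i j)].
  move=> /andP[l0 l1].
  have lphi x : (lam * phi x != 0) = (phi x != 0).
    by rewrite mulf_eq0 (gt_eqF l0).
  have lphi1 x : `|(lam * phi x) *: nu| <= m.
    rewrite normrZ ger0_norm ?mulr_ge0 ?(ltW l0) //.
    apply: le_trans num; apply: ler_piMl => //; have /andP[_ p1] := phi01 x.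
    by apply: mulr_ile1 => //; exact: ltW.
  have slphi : smooth (fun x => lam * phi x) by exact: smooth_scale.
  apply: (@pushed_sknot _ _ K i (fun x => lam * phi x)) => //.
  - by move=> x; rewrite pphi.
  - by move=> x; rewrite mulr_ge0 // ltW.
  - exact: mulr_gt0.
  - move=> x y; rewrite lphi => px e.
    have [k xd] := phid _ px.
    have eu : g (x + k%:~R) *m u = g y *m u.
      by rewrite (periodic1_int _ _ pg) -(coord lam x u nuu) -(coord lam y u nuu) [g x + _]e.
    have ew : g (x + k%:~R) *m w = g y *m w.
      by rewrite (periodic1_int _ _ pg) -(coord lam x w nuw) -(coord lam y w nuw) [g x + _]e.
    (* If [y] is in the bump too, the [u]-coordinate separates the parameters. If not, the two
       points of [K] differ by a nonzero multiple of [nu] and [cross] applies; its second case is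
       the double point itself, where the difference would be zero. *)
    have [py|py] := eqVneq (phi y) 0; last first.
      have [l yd] := phid _ py; exists (k - l).
      rewrite rmorphB /= addrA; apply/eqP; rewrite subr_eq; apply/eqP.
      by apply: near => //; rewrite [RHS](_ : _ = g y *m u) // -/g (periodic1_int _ _ pg).
    have gxy : g y - g x = (lam * phi x) *: nu.
      by move: e; rewrite py mulr0 scale0r addr0 -/g => <-; rewrite addrC addKr.
    have [|||[l e']|[e' [l e'']]] := cross _ y xd => //.
    + by rewrite -/g (periodic1_int _ _ pg) gxy.
    + by exists (k - l); rewrite rmorphB /= addrA -e' addrK.
    have : (lam * phi x) *: nu == 0.
      rewrite -gxy -(periodic1_int k x pg) e' -(periodic1_int l y pg) e''.
      by rewrite -/t1 -/t0 gt subrr.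
    by rewrite scaler_eq0 (negbTE nu0') orbF => /negPn; rewrite lphi px.
  (* The push does not affect the [u]-coordinate of the velocity, which is nonzero on the arc. *)
  - move=> x; rewrite lphi => /phid[k xd].
    apply: contra (imm _ xd) => /eqP e.
    have -> : derive1 (curve K) (x + k%:~R) = derive1 g x.
      by apply: periodic1_int; exact: periodic1_derive1.
    have : (derive1 g x + derive1 (fun x0 => lam * phi x0) x *: nu) *m u = 0.
      by rewrite e mul0mx.
    by rewrite mulmxDl -scalemxAl nuu scaler0 addr0 => ->.
  - by move=> y dy; rewrite lphi => /phid[k]; exact: arc.
have /boolp.choice[F FP] : forall lam, exists K' : sknot R n, 0 < lam <= 1 ->
    [/\ curve K' = (fun x => curve K x + (lam * phi x) *: nu),
        forall j, lo K' j = lo K (lift i j) & forall j, hi K' j = hi K (lift i j)].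
  move=> lam; have [/push[K' P]|_] := boolP (0 < lam <= 1); first by exists K'.
  (* [F] is a total function; outside ]0, 1] the stage 1 serves as filler. *)
  by have [|K' _] := push 1; [rewrite ltr01 lexx|exists K'].
exists (F 1), phi, nu, (t0 - delta), (t0 + delta), F; split=> //.
- split.
  + by rewrite -/t0; case/andP: dlt => d0 _; apply/andP; split; lra.
  + move=> x /phid[k]; rewrite -/t0 ltr_norml => /andP[h1 h2].
    by exists k; apply/andP; split; lra.
  + move=> y k dy /andP[h1 h2]; apply: (arc y k) => //.
    by rewrite ltr_norml; apply/andP; split; lra.
- rewrite det3Z -/g -/t0 -/t1 -/d /c; set sgn := _ ^+ _; set e := m / _.
  have -> : sgn * (sgn * Num.sg d * e * d) = sgn ^+ 2 * (e * (Num.sg d * d)) by ring.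
  rewrite sqrr_sign mul1r -normrEsg mulr_gt0 //; first exact: divr_gt0.
  by rewrite normr_gt0; exact: det0.
Qed.

(** * The weight system of a cup product *)

Lemma half_size_knot_word (R : realType) (n : nat) (K : sknot R n) :
  (size (knot_word K))./2 = n.
Proof.
by rewrite size_map size_sort size_cat !size_map -enumT size_enum_ord addnn doubleK.
Qed.

(** All resolutions of [K] at [S] have the same diagram, which determines the value of [u]; the
    existence of one rules out the default 0 of [xget]. *)
Lemma at_resolution_weight_system (R : realType) (n m : nat) (u : sknot R m -> rat)
    (w : {linear D0 -> rat^o}) (K : sknot R n) (S : {set 'I_n}) (pos : bool) :
  weight_system u w -> n = (m + #|S|)%N ->
  at_resolution u K S pos =
  w (wdiag (erase_cword (labels S) (CWord (knot_cword K)))).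
Proof.
move=> [_ wu] nm.
have val K' : resolves_set pos K S K' ->
    u K' = w (wdiag (erase_cword (labels S) (CWord (knot_cword K)))).
  move=> /resolves_set_knot_word e; rewrite -wu; congr (w _).
  exact: (wdiag_eq (knot_cword K') _ e).
have [K' rK'] := resolves_set_exists (fun n K i => @resolves_exists R n K i pos) K nm.
rewrite /at_resolution; case: xgetP => [r _ [K2 /val e <-]//|/(_ (u K'))[]].
by exists K'.
Qed.

Theorem theorem6p6 (R : realType) (p q : nat) (v1 v2 : knot_invariant R)
    (Hv1 : vassiliev p v1) (Hv2 : vassiliev q v2) (w1 w2 : {linear D0 -> rat^o})
    (Hw1 : weight_system (v1 p) w1) (Hw2 : weight_system (v2 q) w2) :
  let w : {linear D0 -> rat^o} := (-1) ^+ (p * q) \*: (tensor q w1 w2 \o Delta0) in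
  weight_system (cup (v1 p) (v2 q)) w /\
  (A0_dual w1 -> A0_dual w2 -> A0_dual w).
Proof.
move=> w; have [hom1 _] := Hw1; have [hom2 _] := Hw2.
have wE x : w x = (-1) ^+ (p * q) * (tensor q w1 w2 \o Delta0) x by [].
split; last first.
  move=> a1 a2 r rT; rewrite wE.
  by rewrite (A0_dual_tensor_Delta0 q a1 a2 rT) mulr0.
split=> [D Dpq|K]; rewrite wE.
  by rewrite (homogeneous_tensor_Delta0 hom1 hom2 Dpq) mulr0.
rewrite -[(_ \o _) _]/(tensor q w1 w2 (Delta0 << cdiag_of (CWord (knot_cword K)) >>)).
rewrite (@tensor_Delta0 _ q w1 w2 (CWord _) (half_size_knot_word K)) mulr_sumr.
rewrite /cup [RHS]big_mkcond; apply: eq_bigr => H _.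
(* The coproduct runs over all [H], the cup product over those of size [p]; the other terms vanish
   because [w1] has degree [p]. *)
set W := CWord _; case: eqP => [Hp|/eqP Hp]; last first.
  rewrite (homogeneous_wdiag _ hom1) ?mulr0 ?mul0r ?mulr0 //.
  rewrite size_erase_cword ?half_size_knot_word; last exact: knot_cword.
  by rewrite relabel_labels finset.setCK.
have HC : #|~: H|%SET = q.
  by apply/eqP; rewrite -(eqn_add2l p) -{1}Hp cardsC card_ord.
rewrite (at_resolution_weight_system _ _ Hw1) ?HC //.
rewrite (at_resolution_weight_system _ _ Hw2) ?Hp 1?addnC //.
set A := w1 _; set B := w2 _.
(* The sign from evaluating the tensor of functionals meets the sign of the statement, and their
   product is a square. *)
have -> : (-1) ^+ (p * q) * (rho H * ((-1) ^+ (q * p) * A * B)) =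
    ((-1) ^+ (p * q)) ^+ 2 * (rho H * A * B) by rewrite [(q * p)%N]mulnC; ring.
by rewrite sqrr_sign mul1r.
Qed.
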